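(* Let $M>0$ and $\delta>0$, and let $\{X_n,\ n\ge 1\}$ be a sequence of identically distributed random variables which is $M$-acceptable with parameter $\delta$ and satisfies $\mathbb{E}\,e^{\delta|X_1|}<\infty$. Put $K=(\mathbb{E}|X_1|^2)^{1/2}\,\mathbb{E}\,e^{\delta|X_1|}$. Then for every $\varepsilon\ge K$ and every $n\ge 1$, $$\mathbb{P}\Big(\Big|\sum_{i=1}^n (X_i-\mathbb{E}X_i)\Big|>n\varepsilon\Big)\le 2M\exp\Big(-\frac{n\delta}{2}(\varepsilon-K)\Big).$$
   Context: All random variables are real-valued and defined on a fixed probability space $(\Omega,\mathcal{F},\mathbb{P})$; no independence is assumed. For $M>0$ and $\delta>0$, a sequence $\{X_n,\ n\ge1\}$ is called $M$-acceptable with parameter $\delta$ if for every $n\ge 1$ and every real $\lambda$ with $|\lambda|\le\delta$, $$\mathbb{E}\exp\Big(\lambda\sum_{i=1}^n X_i\Big)\le M\prod_{i=1}^n \mathbb{E}\exp(\lambda X_i).$$ *)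

(* Defs.v *)
From HB Require Import structures.
From mathcomp Require Import all_boot all_order all_algebra.
From mathcomp Require Import all_classical all_reals all_analysis.

Set Implicit Arguments.
Unset Strict Implicit.
Unset Printing Implicit Defensive.

Import Order.TTheory GRing.Theory Num.Theory.
Import numFieldNormedType.Exports.

Local Open Scope classical_set_scope.
Local Open Scope ring_scope.

(* Sequences X_1, X_2, ... are indexed from 0: [X i] stands for X_(i+1), so
   [\sum_(i < n) X i] is X_1 + ... + X_n. *)

Definition identically_distributed (d : measure_display)
    (T : measurableType d) (R : realType) (P : probability T R)
    (X : nat -> {RV P >-> R}) : Prop :=
  forall (i : nat) (A : set R), measurable A ->
    distribution P (X i) A = distribution P (X 0%N) A.

(* Both sides are extended reals, so the inequality is meaningful even when
   some of the exponential moments are infinite. *)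
Definition acceptable (d : measure_display) (T : measurableType d)
    (R : realType) (P : probability T R) (M delta : R)
    (X : nat -> {RV P >-> R}) : Prop :=
  forall (n : nat) (lambda : R), (0 < n)%N -> `|lambda| <= delta ->
    ('E_P[fun w => expR (lambda * \sum_(i < n) X i w)]
       <= M%:E * \prod_(i < n) 'E_P[fun w => expR (lambda * X i w)])%E.

(* [fine] sends infinite expectations to 0. It is harmless here when
   E exp (delta |Y|) is finite for some delta > 0, since then all moments of Y
   are finite. *)
Definition momentK (d : measure_display) (T : measurableType d)
    (R : realType) (P : probability T R) (delta : R) (Y : {RV P >-> R}) : R :=
  Num.sqrt (fine 'E_P[fun w => `|Y w| ^+ 2]) *
  fine 'E_P[fun w => expR (delta * `|Y w|)].

Arguments identically_distributed {d T R} P X.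
Arguments acceptable {d T R} P M delta X.
Arguments momentK {d T R} P delta Y.

(* Main.v *)
(* The one-variable estimate is: if [2 |l| <= delta], then
   [E exp (l Y) <= exp (l E Y + |l| K)].
   It comes from [e^x <= 1 + x + |x| e^|x|], where the expectation of the last
   term at [x = l Y] is bounded by Cauchy-Schwarz:
   [E (|Y| e^(|l| |Y|)) <= (E Y^2)^(1/2) (E e^(delta |Y|))^(1/2) <= K],
   as [E e^(delta |Y|) >= 1]. Acceptability turns this into a bound on the
   moment generating function of the sum, and Chernoff's bound with
   [l = delta / 2] and [l = - delta / 2] controls the two tails. *)

Require Import Defs.
From HB Require Import structures.
From mathcomp Require Import all_boot all_order all_algebra.
From mathcomp Require Import all_classical all_reals all_analysis.
From mathcomp Require Import measurable_realfun ring lra.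

Set Implicit Arguments.
Unset Strict Implicit.
Unset Printing Implicit Defensive.

Import Order.TTheory GRing.Theory Num.Theory.
Import numFieldNormedType.Exports.

Local Open Scope classical_set_scope.
Local Open Scope ring_scope.

(** * Pointwise bounds on the exponential *)

Lemma expR_le_1Dx_norm (R : realType) (x : R) :
  expR x <= 1 + x + `|x| * expR `|x|.
Proof.
have [x0|x0] := leP 0 x.
  (* [1 - x <= expR (- x)], multiplied by [expR x] *)
  have: (1 - x) * expR x <= 1.
    by rewrite -[leRHS](expRxMexpNx_1 x) mulrC ler_pM2l ?expR_gt0// expR_ge1Dx.
  rewrite ger0_norm//; lra.
(* For [x < 0] the right-hand side is at least [1 + x + |x| = 1]. *)
have : expR x <= 1 by rewrite expR_le1 ltW.
have : 1 <= expR `|x| by rewrite -expR0 ler_expR.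
rewrite ltr0_norm//; nra.
Qed.

(** Pointwise substitute for Cauchy-Schwarz, with a free weight [r]. The condition on [lambda] lets
    [expR (delta * |y|)] dominate the square of [expR (|lambda| * |y|)]. *)
Lemma expRM_le_quadratic (R : realType) (delta lambda r y : R) :
  0 < r -> 2 * `|lambda| <= delta ->
  expR (lambda * y) <=
    1 + lambda * y
    + `|lambda| / 2 * (r * `|y| ^+ 2 + r^-1 * expR (delta * `|y|)).
Proof.
move=> r0 ld; apply: (le_trans (expR_le_1Dx_norm _)); rewrite lerD2l normrM.
rewrite -!mulrA ler_wpM2l//.
set u := `|y|; set v := expR (`|lambda| * u).
have v2 : v ^+ 2 <= expR (delta * u).
  by rewrite -expRM_natl ler_expR mulrA ler_wpM2r ?normr_ge0.
(* AM-GM: becomes Cauchy-Schwarz once [r] is optimized after integration. *)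
have : 0 <= (r * u - v) ^+ 2 / r by rewrite divr_ge0 ?sqr_ge0// ltW.
have -> : (r * u - v) ^+ 2 / r = r * u ^+ 2 - 2 * (u * v) + r^-1 * v ^+ 2.
  by field; rewrite gt_eqF.
have : r^-1 * v ^+ 2 <= r^-1 * expR (delta * u) by rewrite ler_pM2l ?invr_gt0.
lra.
Qed.

(** Keeps only the quadratic term of the exponential series; this domination makes the second moment
    finite. *)
Lemma normrX2_le_expR (R : realType) (delta y : R) : 0 < delta ->
  `|y| ^+ 2 <= 2 / delta ^+ 2 * expR (delta * `|y|).
Proof.
move=> d0; have /(expR_ge1Dxn 1) : 0 <= delta * `|y| by rewrite mulr_ge0// ltW.
rewrite (_ : 2`! = 2)%N// => h.
rewrite -(@ler_pM2l _ (delta ^+ 2 / 2)) ?divr_gt0 ?exprn_gt0//.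
rewrite [leRHS](_ : _ = expR (delta * `|y|)); last by field; rewrite gt_eqF.
by apply: le_trans h; rewrite exprMn; lra.
Qed.

Lemma lee_prod (R : realType) (I : Type) (r : seq I) (F G : I -> \bar R) :
  (forall i, 0 <= F i)%E -> (forall i, F i <= G i)%E ->
  (\prod_(i <- r) F i <= \prod_(i <- r) G i)%E.
Proof.
move=> F0 FG.
(* Products of inequalities require nonnegative factors, so the induction carries nonnegativity
   along. *)
suff /andP[] : (0 <= \prod_(i <- r) F i <= \prod_(i <- r) G i)%E by [].
elim/big_ind2 : _ => [|x1 x2 y1 y2 /andP[x10 x12] /andP[y10 y12]|i _].
- by rewrite lee01 lexx.
- by rewrite mule_ge0//= lee_pmul.
- by rewrite F0 FG.
Qed.

Lemma measurable_expR_norm (R : realType) (delta : R) :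
  measurable_fun setT (fun y : R => expR (delta * `|y|)).
Proof. by apply: measurableT_comp => //; exact: measurable_funM. Qed.

Lemma Rintegral_probability_cst d (T : measurableType d) (R : realType)
  (P : probability T R) (c : R) : \int[P]_w c = c.
Proof.
by rewrite Rintegral_cst// [X in fine X]probability_setT mulr1.
Qed.

(** * One variable with a finite exponential moment *)

Section exponential_moment.
Context d (T : measurableType d) (R : realType) (P : probability T R).
Variables (delta : R) (Y : {RV P >-> R}).
Hypothesis delta_gt0 : 0 < delta.
Hypothesis Y_exp : ('E_P[fun w => expR (delta * `|Y w|)] < +oo)%E.

Let mY : measurable_fun setT (Y : T -> R). Proof. exact: measurable_funPT. Qed.

Let mexp : measurable_fun setT (fun w => expR (delta * `|Y w|)).
Proof. exact: measurableT_comp (measurable_expR_norm delta) mY. Qed.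

Lemma integrable_expR_norm :
  P.-integrable setT (EFin \o (fun w => expR (delta * `|Y w|))).
Proof.
apply/integrableP; split; first exact/measurable_EFinP.
apply: le_lt_trans Y_exp; rewrite unlock.
under eq_integral do rewrite /= ger0_norm ?expR_ge0//.
exact: lexx.
Qed.

Lemma integrable_normrX2 :
  P.-integrable setT (EFin \o (fun w => `|Y w| ^+ 2)).
Proof.
apply: (le_integrable _ _ _ (integrableZl _ (2 / delta ^+ 2)
  integrable_expR_norm)) => //.
  by apply/measurable_EFinP; apply: measurable_funX; exact: measurableT_comp.
move=> w _ /=; rewrite lee_fin ger0_norm// [leRHS]ger0_norm; last first.
  by rewrite mulr_ge0 ?expR_ge0// divr_ge0// exprn_ge0// ltW.
exact: normrX2_le_expR.
Qed.

Lemma integrable_RV : P.-integrable setT (EFin \o Y).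
Proof.
apply: (le_integrable _ _ _ (integrableZl _ delta^-1
  integrable_expR_norm)) => //.
  exact/measurable_EFinP.
move=> w _ /=; rewrite lee_fin [leRHS]ger0_norm; last first.
  by rewrite mulr_ge0 ?expR_ge0// invr_ge0 ltW.
rewrite mulrC ler_pdivlMr// mulrC.
by apply: le_trans (expR_ge1Dx _); rewrite lerDr.
Qed.

Lemma fine_expectation_expR_ge1 :
  1 <= fine 'E_P[fun w => expR (delta * `|Y w|)].
Proof.
rewrite unlock -[leLHS](Rintegral_probability_cst P).
apply: le_Rintegral => //.
- exact: finite_measure_integrable_cst.
- exact: integrable_expR_norm.
- by move=> w _; rewrite -expR0 ler_expR mulr_ge0// ltW.
Qed.

Lemma expectation_expR_le_quadratic (lambda r : R) :
  0 < r -> 2 * `|lambda| <= delta ->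
  ('E_P[fun w => expR (lambda * Y w)] <=
   (1 + lambda * fine 'E_P[Y] + `|lambda| / 2 *
     (r * fine 'E_P[fun w => `|Y w| ^+ 2]
      + r^-1 * fine 'E_P[fun w => expR (delta * `|Y w|)]))%:E)%E.
Proof.
move=> r0 ld.
have i1 : P.-integrable setT (EFin \o cst (1 : R)).
  exact: finite_measure_integrable_cst.
have iY : P.-integrable setT (EFin \o (fun w => lambda * Y w)).
  exact: (integrableZl _ lambda integrable_RV).
have i2 : P.-integrable setT (EFin \o (fun w => r * `|Y w| ^+ 2)).
  exact: (integrableZl _ r integrable_normrX2).
have ie : P.-integrable setT
    (EFin \o (fun w => r^-1 * expR (delta * `|Y w|))).
  exact: (integrableZl _ r^-1 integrable_expR_norm).
have i2e : P.-integrable setT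
    (EFin \o (fun w => r * `|Y w| ^+ 2 + r^-1 * expR (delta * `|Y w|))).
  exact: (integrableD _ i2 ie).
have i1Y : P.-integrable setT (EFin \o (fun w => 1 + lambda * Y w)).
  exact: (integrableD _ i1 iY).
have il : P.-integrable setT (EFin \o (fun w => `|lambda| / 2 *
    (r * `|Y w| ^+ 2 + r^-1 * expR (delta * `|Y w|)))).
  exact: (integrableZl _ (`|lambda| / 2) i2e).
have itot : P.-integrable setT (EFin \o (fun w => 1 + lambda * Y w +
    `|lambda| / 2 * (r * `|Y w| ^+ 2 + r^-1 * expR (delta * `|Y w|)))).
  exact: (integrableD _ i1Y il).
(* The bound is folded into a single integral of the pointwise majorant. That majorant is
   integrable, so [fine] loses nothing and monotonicity of the integral concludes. *)
have -> : (1 + lambda * fine 'E_P[Y] + `|lambda| / 2 *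
     (r * fine 'E_P[fun w => `|Y w| ^+ 2]
      + r^-1 * fine 'E_P[fun w => expR (delta * `|Y w|)])) =
    \int[P]_w (1 + lambda * Y w + `|lambda| / 2 *
      (r * `|Y w| ^+ 2 + r^-1 * expR (delta * `|Y w|))).
  rewrite RintegralD// RintegralD// RintegralZl//; last exact: integrable_RV.
  rewrite RintegralZl// RintegralD// RintegralZl//; last first.
    exact: integrable_normrX2.
  rewrite RintegralZl//; last exact: integrable_expR_norm.
  by rewrite Rintegral_probability_cst unlock.
rewrite /Rintegral fineK; last exact: integrable_fin_num itot.
rewrite unlock; apply: ge0_le_integral => //.
- apply/measurable_EFinP; apply: measurableT_comp => //.
  exact: measurable_funM.
- exact: measurable_int itot.
- by move=> w _; rewrite lee_fin; exact: expRM_le_quadratic.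
Qed.

Lemma expectation_expR_le (lambda : R) : 2 * `|lambda| <= delta ->
  ('E_P[fun w => expR (lambda * Y w)] <=
   (expR (lambda * fine 'E_P[Y] + `|lambda| * momentK P delta Y))%:E)%E.
Proof.
move=> ld; rewrite /momentK.
have A0 : 0 <= fine 'E_P[fun w => `|Y w| ^+ 2].
  by rewrite fine_ge0// expectation_ge0.
have B1 := fine_expectation_expR_ge1.
have quad r := @expectation_expR_le_quadratic lambda r.
move: A0 B1 quad.
set m := fine 'E_P[Y]; set A := fine _; set B := fine _ => A0 B1 quad.
set s := Num.sqrt A.
have As : A = s ^+ 2 by rewrite sqr_sqrtr.
have s0 : 0 <= s by exact: sqrtr_ge0.
apply: (@le_trans _ _ (1 + (lambda * m + `|lambda| * (s * B)))%:E); last first.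
  by rewrite lee_fin expR_ge1Dx.
(* Optimal choice [r = 1 / s], perturbed because [s] may vanish. *)
apply/lee_addgt0Pr => e e0.
(* Chosen so that the error [|lambda| * B * t] is at most [e]; the [+ 1] keeps the denominator
   positive when [lambda = 0]. *)
pose t := e / (`|lambda| * B + 1).
have D0 : 0 < `|lambda| * B + 1.
  by rewrite ltr_wpDl// mulr_ge0// (le_trans ler01).
have t0 : 0 < t by rewrite divr_gt0.
have st0 : 0 < s + t by rewrite ltr_wpDl.
apply: (le_trans (quad (s + t)^-1 _ ld)); first by rewrite invr_gt0.
rewrite -EFinD lee_fin invrK As.
have te : `|lambda| * B * t <= e.
  rewrite /t mulrA ler_pdivrMr// mulrC ler_pM2l//; lra.
have h : (s + t)^-1 * s ^+ 2 <= s.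
  by rewrite mulrC ler_pdivrMr//; nra.
(* Here [B >= 1] enters, through [s <= s * B]. The factor 2 cancels the [/ 2] of the quadratic bound
   and leaves [|lambda| * (s * B)] plus the error. *)
have h2 : (s + t)^-1 * s ^+ 2 + (s + t) * B <= 2 * (s * B) + 2 * (B * t).
  nra.
have := ler_wpM2l (normr_ge0 lambda) h2.
lra.
Qed.

End exponential_moment.

(** * Transfer between identically distributed variables *)

Section identical_distribution.
Context d (T : measurableType d) (R : realType) (P : probability T R).

(** Both sides are integrals of [f] against the same image measure. As [f] is nonnegative, infinite
    values are allowed, so finiteness of a moment can be transferred too. *)
Lemma ge0_expectation_id (X Y : {RV P >-> R}) (f : R -> R) :
  (forall A, measurable A -> distribution P X A = distribution P Y A) ->
  measurable_fun setT f -> (forall x, 0 <= f x) ->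
  ('E_P[f \o X] = 'E_P[f \o Y])%E.
Proof.
move=> XY mf f0; rewrite unlock.
have mEf : measurable_fun setT (EFin \o f) by exact/measurable_EFinP.
have Ef0 y : (0 <= (EFin \o f) y)%E by rewrite lee_fin.
rewrite -(@ge0_integral_distribution _ _ _ _ _ _ X (EFin \o f))//.
rewrite -(@ge0_integral_distribution _ _ _ _ _ _ Y (EFin \o f))//.
by apply: eq_measure_integral => A mA _; exact: XY.
Qed.

Lemma momentK_id (delta : R) (X Y : {RV P >-> R}) :
  (forall A, measurable A -> distribution P X A = distribution P Y A) ->
  momentK P delta X = momentK P delta Y.
Proof.
move=> XY; rewrite /momentK; congr (Num.sqrt (fine _) * fine _).
  apply: (@ge0_expectation_id X Y (fun y => `|y| ^+ 2)) => //.
  exact: measurable_funX.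
apply: (@ge0_expectation_id X Y (fun y => expR (delta * `|y|))) => //.
  exact: measurable_expR_norm.
Qed.

End identical_distribution.

(** * Moment generating function and tails of the sums *)

Section acceptable_tail.
Context d (T : measurableType d) (R : realType) (P : probability T R).
Variables (M delta : R) (X : nat -> {RV P >-> R}).
Hypothesis M_gt0 : 0 < M.
Hypothesis delta_gt0 : 0 < delta.
Hypothesis X_id : identically_distributed P X.
Hypothesis X_acc : acceptable P M delta X.
Hypothesis X_exp : ('E_P[fun w => expR (delta * `|X 0%N w|)] < +oo)%E.

Let K := momentK P delta (X 0%N).

(** Acceptability reduces the claim to single factors, all with the same [K]. The means stay indexed
    by [i], ready to cancel against the centering. *)
Lemma acceptable_mgf_le (n : nat) (lambda : R) : (0 < n)%N ->
  2 * `|lambda| <= delta ->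
  ('E_P[fun w => expR (lambda * \sum_(i < n) X i w)] <=
   (M * expR (\sum_(i < n) (lambda * fine 'E_P[X i] + `|lambda| * K)))%:E)%E.
Proof.
move=> n0 ld; have ld' : `|lambda| <= delta by have := normr_ge0 lambda; lra.
apply: (le_trans (X_acc n0 ld')).
rewrite EFinM lee_pmul2l ?lte_fin//.
rewrite expR_sum -prodEFin; apply: lee_prod => i.
  by rewrite expectation_ge0// => w; exact: expR_ge0.
have Xie : ('E_P[fun w => expR (delta * `|X i w|)] < +oo)%E.
  apply: le_lt_trans X_exp.
  rewrite (@ge0_expectation_id _ _ _ _ (X i) (X 0%N)
    (fun y => expR (delta * `|y|)) (X_id i))//.
  exact: measurable_expR_norm.
by rewrite /K -(momentK_id delta (X_id i)) expectation_expR_le.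
Qed.

(** The sign [s] treats both tails at once: Chernoff at [delta / 2] for [s] times the sum calls for
    the moment bound at [s * delta / 2]. *)
Lemma acceptable_tail_le (s eps : R) (n : nat) : `|s| = 1 -> (0 < n)%N ->
  (P [set w | (n%:R * eps <= s * \sum_(i < n) (X i w - fine 'E_P[X i]))%R]
   <= (M * expR (- (n%:R * delta / 2) * (eps - K)))%:E)%E.
Proof.
move=> s1 n0.
pose m := \sum_(i < n) fine 'E_P[X i].
have mS : measurable_fun setT (fun w => s * \sum_(i < n) X i w).
  apply: measurable_funM => //; apply: measurable_sum => i.
  exact: measurable_funPT.
pose S : {RV P >-> R} := mfun_Sub (mem_set mS).
(* Acceptability concerns uncentered sums, so the centering is moved into the threshold. *)
have -> : [set w | n%:R * eps <= s * \sum_(i < n) (X i w - fine 'E_P[X i])]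
    = [set w | n%:R * eps + s * m <= S w].
  by apply/eq_set => w; rewrite /= sumrB mulrBr lerBrDr.
have d20 : 0 < delta / 2 by rewrite divr_gt0.
apply: (le_trans (chernoff S _ d20)).
have ld : 2 * `|delta / 2 * s| <= delta.
  by rewrite normrM s1 gtr0_norm//; lra.
rewrite /mmt_gen_fun.
have -> : expR \o delta / 2 \o* (S : T -> R)
    = (fun w => expR (delta / 2 * s * \sum_(i < n) X i w)).
  by apply/funext => w /=; rewrite mulrC mulrA.
apply: (le_trans (lee_wpmul2r _ (acceptable_mgf_le n0 ld))).
  by rewrite lee_fin expR_ge0.
rewrite -EFinM lee_fin -[leLHS]mulrA -expRD ler_pM2l// ler_expR.
(* The means add up to [delta / 2 * s * m], which cancels the shift of the threshold. *)
rewrite big_split/= -mulr_sumr -/m sumr_const card_ord.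
rewrite normrM s1 gtr0_norm// -mulr_natl; lra.
Qed.

End acceptable_tail.

Theorem theorem1 (d : measure_display) (T : measurableType d) (R : realType)
    (P : probability T R) (M delta : R) (X : nat -> {RV P >-> R})
    (M_gt0 : 0 < M) (delta_gt0 : 0 < delta)
    (X_id : identically_distributed P X)
    (X_acc : acceptable P M delta X)
    (X_exp : ('E_P[fun w => expR (delta * `|X 0%N w|)] < +oo)%E)
    (eps : R) (eps_ge : momentK P delta (X 0%N) <= eps)
    (n : nat) (n_gt0 : (0 < n)%N) :
  (P [set w | (n%:R * eps < `|\sum_(i < n) (X i w - fine 'E_P[X i])|)%R]
   <= (2 * M * expR (- (n%:R * delta / 2)
                     * (eps - momentK P delta (X 0%N))))%R%:E)%E.
Proof.
set K := momentK P delta (X 0%N).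
set c := M * expR (- (n%:R * delta / 2) * (eps - K)).
pose D w := \sum_(i < n) (X i w - fine 'E_P[X i]).
pose A (s : R) := [set w | n%:R * eps <= s * D w].
have mD : measurable_fun setT D.
  apply: measurable_sum => i.
  by apply: measurable_funB => //; exact: measurable_funPT.
have mA s : measurable (A s).
  rewrite (_ : A s = (fun w => s * D w) @^-1` `[n%:R * eps, +oo[%classic).
    by rewrite -[X in measurable X]setTI; apply: measurable_funM.
  by apply/seteqP; split => w /=; rewrite /A /= in_itv/= andbT.
have PA s : `|s| = 1 -> (P (A s) <= c%:E)%E.
  by move=> s1; exact: (acceptable_tail_le M_gt0 delta_gt0 X_id X_acc X_exp).
(* The sign of [D w] decides which one-sided event holds; the union bound gives [c + c]. *)
apply: (@le_trans _ _ (P (A 1%R `|` A (-1)%R))).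
  apply: le_measure; rewrite ?inE//.
  - rewrite [X in measurable X](_ : _ =
        (fun w => `|D w|) @^-1` `]n%:R * eps, +oo[%classic).
      by rewrite -[X in measurable X]setTI; apply: measurableT_comp.
    by apply/seteqP; split => w /=; rewrite in_itv/= andbT.
  - exact: measurableU.
  - move=> w /= /ltW; rewrite /A /= mul1r mulN1r -/(D w).
    by case: (leP 0 (D w)) => [/ger0_norm|/ltr0_norm] -> ?; [left|right].
apply: (le_trans (measureU2 P (mA _) (mA _))).
rewrite [leRHS](_ : _ = (c%:E + c%:E)%E); last first.
  by rewrite -EFinD /c; congr EFin; ring.
by apply: leeD; apply: PA; rewrite ?normrN normr1.
Qed.
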